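(* Let $\Gamma$ be an oriented closed and strictly convex regular $C^2$-curve in $\mathbb{R}^2$, and let $k$ be an upper bound of its curvature function $\kappa:\Gamma\to\mathbb{R}$. Let $P$ be a polygon inscribed in $\Gamma$ (its vertices lie on $\Gamma$ and follow each other according to the orientation of $\Gamma$), and let $\lambda$ be an upper bound of the arclength on $\Gamma$ between all consecutive vertices of $P$, such that $$\lambda<\frac{\pi}{2k}.$$ Then $$\delta(P)\;\leq\;\delta(\Gamma)\;\leq\;\delta(P)+\lambda\cdot\tan(k\lambda).$$ Thus, if $\lambda$ tends to $0$, $\delta(P)$ tends to $\delta(\Gamma)$ with an error term of order $\mathcal{O}(\lambda^2)$.
   Context: For a nonempty bounded subset $X$ of $\mathbb{R}^2$ with the restricted Euclidean metric $d$, $\delta(X):=\inf_{p\in X}\sup_{q\in X} d(p,q)$. Here $\Gamma$ is a simple closed curve bounding a compact convex set with nonempty interior $\Omega$, oriented so that $\Omega$ lies to the left, and $\kappa$ is its curvature with respect to this orientation (so $\kappa\ge 0$). The polygon $P$ is understood as the closed polygonal curve (the union of its edges), not the region it bounds. *)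

(* Defs.v *)
From Stdlib Require Import Reals.
From Coquelicot Require Import Coquelicot.

Open Scope R_scope.

(* Coquelicot's norm on a product is the Euclidean one,
   sqrt (norm x ^ 2 + norm y ^ 2). *)
Definition plane : NormedModule R_AbsRing :=
  prod_NormedModule R_AbsRing R_NormedModule R_NormedModule.

Definition euclid_dist (p q : plane) : R := norm (minus p q).

(* Only meaningful for nonempty bounded X: [real] sends infinite bounds to 0. *)
Definition delta (X : plane -> Prop) : R :=
  real (Glb_Rbar (fun r => exists p, X p /\
    r = real (Lub_Rbar (fun s => exists q, X q /\ s = euclid_dist p q)))).

Definition segment (p q : plane) : plane -> Prop := fun r =>
  exists s, 0 <= s <= 1 /\ r = plus (scal (1 - s) p) (scal s q).

Definition compact_set {U : UniformSpace} (A : U -> Prop) : Prop :=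
  forall (I : Type) (V : I -> U -> Prop),
    (forall i, open (V i)) ->
    (forall p, A p -> exists i, V i p) ->
    exists l : list I, forall p, A p -> exists i, List.In i l /\ V i p.

Definition interior_set {U : UniformSpace} (A : U -> Prop) : U -> Prop :=
  fun p => locally p A.

Definition boundary {U : UniformSpace} (A : U -> Prop) : U -> Prop :=
  fun p => ~ interior_set A p /\ ~ interior_set (fun q => ~ A q) p.

Definition convex_set (A : plane -> Prop) : Prop :=
  forall p q, A p -> A q -> forall r, segment p q r -> A r.

Definition contains_no_segment (A : plane -> Prop) : Prop :=
  forall p q, (forall r, segment p q r -> A r) -> p = q.

Definition derive_curve (n : nat) (g : R -> plane) (t : R) : plane :=
  (Derive_n (fun u => fst (g u)) n t, Derive_n (fun u => snd (g u)) n t).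

Definition velocity := derive_curve 1.
Definition acceleration := derive_curve 2.

(* [ex_derive_n f 2] alone only says that the total function [Derive f] is
   differentiable, hence the quantification over both orders. *)
Definition C2_curve (g : R -> plane) : Prop :=
  (forall t n, (n <= 2)%nat ->
     ex_derive_n (fun u => fst (g u)) n t /\
     ex_derive_n (fun u => snd (g u)) n t) /\
  (forall t, continuous (acceleration g) t).

Definition cross (u v : plane) : R := fst u * snd v - snd u * fst v.

(* Signed curvature in an arbitrary regular parametrization. *)
Definition curvature (g : R -> plane) (t : R) : R :=
  cross (velocity g t) (acceleration g t) / norm (velocity g t) ^ 3.

Definition left_normal (g : R -> plane) (t : R) : plane :=
  (- snd (velocity g t), fst (velocity g t)).

Definition arclength (g : R -> plane) (a b : R) : R :=
  RInt (fun t => norm (velocity g t)) a b.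

Definition trace (g : R -> plane) : plane -> Prop := fun p => exists t, p = g t.

(* [g] is a [T]-periodic parametrization of the curve; [Omega] is the convex
   set it bounds. *)
Record strictly_convex_C2_curve
    (g : R -> plane) (T : R) (Omega : plane -> Prop) : Prop := {
  curve_period_pos : 0 < T;
  curve_periodic : forall t, g (t + T) = g t;
  curve_simple : forall s t, 0 <= s < T -> 0 <= t < T -> g s = g t -> s = t;
  curve_C2 : C2_curve g;
  curve_regular : forall t, velocity g t <> zero;
  domain_compact : compact_set Omega;
  domain_convex : convex_set Omega;
  domain_interior : exists p, interior_set Omega p;
  curve_bounds : forall p, trace g p <-> boundary Omega p;
  curve_strictly_convex : contains_no_segment (trace g);
  curve_domain_left : forall t, exists e, 0 < e /\
    forall s, 0 < s < e -> Omega (plus (g t) (scal s (left_normal g t)))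
}.

(* [t 0 < ... < t n = t 0 + T]: the parameters of the vertices over one
   positive turn, the vertex of index [n] being the vertex of index [0]. *)
Definition inscribed (T : R) (n : nat) (t : nat -> R) : Prop :=
  (3 <= n)%nat /\ (forall i, (i < n)%nat -> t i < t (S i)) /\
  t n = t O + T.

Definition polygon (n : nat) (v : nat -> plane) : plane -> Prop := fun p =>
  exists i, (i < n)%nat /\ segment (v i) (v (S i)) p.

Definition arclength_bound
    (g : R -> plane) (n : nat) (t : nat -> R) (lambda : R) : Prop :=
  forall i, (i < n)%nat -> arclength g (t i) (t (S i)) <= lambda.

(* Main.v *)
Require Import Defs.
From Stdlib Require Import ZArith Reals Lra Lia Classical.
From Coquelicot Require Import Coquelicot.

Open Scope R_scope.

(** Lower bound: let [g s] lie on the arc cut off by the edge [a, b], and let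
    [p'] be the point of that edge nearest to [g s]. By convexity the segment
    from [g s] to any other vertex crosses the edge, so moving from [g s] to
    [p'] brings all vertices closer.

    Upper bound: the tangent direction turns by at most [k * lambda] along the
    arc over an edge and is somewhere parallel to the edge. Hence the arc is a
    graph over its chord with slope at most [tan (k * lambda)], of height at
    most half the chord length times this slope. A point of the polygon and a
    farthest point of the curve are each replaced by the point facing it across
    the chord, which costs twice that height. *)

(** Convexity is given only through the set [Omega]: inner normals enter it and its boundary is the
    curve. What both bounds consume are signs of cross products: every tangent supports [Omega] and
    meets the curve in a single point. These signs yield the cyclic order of any three points of the
    curve, which is why segments cross the edge in the lower bound. They also yield nonnegative
    curvature, without which an upper bound [k] would not limit turning in the other direction. The
    turning of the tangent is defined as the integral of curvature times speed and tied to the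
    velocity by differentiation, so no branch of an angle is ever chosen. The condition on [lambda]
    keeps this turning below a right angle, where cosines are positive and the tangent function is
    monotone. *)

(** * Euclidean distance in coordinates *)

Lemma norm_planeE (p : plane) : norm p = sqrt (fst p ^ 2 + snd p ^ 2).
Proof.
change (norm p) with (sqrt (Rabs (fst p) ^ 2 + Rabs (snd p) ^ 2)).
now rewrite !pow2_abs.
Qed.

Lemma euclid_distE (p q : plane) :
  euclid_dist p q = sqrt ((fst p - fst q) ^ 2 + (snd p - snd q) ^ 2).
Proof. exact (norm_planeE (minus p q)). Qed.

Lemma euclid_dist_nonneg (p q : plane) : 0 <= euclid_dist p q.
Proof. apply norm_ge_0. Qed.

Lemma euclid_dist_sym (p q : plane) : euclid_dist p q = euclid_dist q p.
Proof. rewrite !euclid_distE; f_equal; ring. Qed.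

Lemma euclid_dist_triangle (p q r : plane) :
  euclid_dist p r <= euclid_dist p q + euclid_dist q r.
Proof.
unfold euclid_dist; replace (minus p r) with (plus (minus p q) (minus q r)).
- apply (norm_triangle (minus p q) (minus q r)).
- apply injective_projections; simpl; unfold minus, plus, opp; simpl; ring.
Qed.

Lemma euclid_dist_eq0 (p q : plane) : euclid_dist p q = 0 -> p = q.
Proof.
rewrite euclid_distE; intros h; apply sqrt_eq_0 in h;
  [|apply Rplus_le_le_0_compat; apply pow2_ge_0].
destruct (Rplus_sqr_eq_0 (fst p - fst q) (snd p - snd q)) as [h1 h2].
{ unfold Rsqr; rewrite <- h; ring. }
apply injective_projections; now apply Rminus_diag_uniq.
Qed.

Lemma euclid_dist_le (p q : plane) (r : R) : 0 <= r ->
  (fst p - fst q) ^ 2 + (snd p - snd q) ^ 2 <= r ^ 2 -> euclid_dist p q <= r.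
Proof.
intros hr h; rewrite euclid_distE, <- (sqrt_pow2 r hr).
now apply sqrt_le_1_alt.
Qed.

Lemma euclid_dist_mono (p q p' q' : plane) :
  (fst p - fst q) ^ 2 + (snd p - snd q) ^ 2 <=
    (fst p' - fst q') ^ 2 + (snd p' - snd q') ^ 2 ->
  euclid_dist p q <= euclid_dist p' q'.
Proof. intros h; rewrite !euclid_distE; now apply sqrt_le_1_alt. Qed.

(** * Comparing values of delta *)

Definition farthest (X : plane -> Prop) (p : plane) : R :=
  real (Lub_Rbar (fun s => exists q, X q /\ s = euclid_dist p q)).

Definition bounded_set (X : plane -> Prop) : Prop :=
  exists M, forall p q, X p -> X q -> euclid_dist p q <= M.

(** Boundedness excludes the supremum [p_infty] and the point [p] itself excludes [m_infty], so
    [real] loses nothing here. *)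
Lemma farthest_lub (X : plane -> Prop) (p : plane) : bounded_set X -> X p ->
  is_lub_Rbar (fun s => exists q, X q /\ s = euclid_dist p q) (farthest X p).
Proof.
intros [M hM] hp; unfold farthest.
assert (h := Lub_Rbar_correct (fun s => exists q, X q /\ s = euclid_dist p q)).
destruct (Lub_Rbar _) as [r| |]; simpl; auto; exfalso.
- apply (proj2 h (Finite M)); intros s [q [hq ->]]; simpl; auto.
- apply (proj1 h (euclid_dist p p)); now exists p.
Qed.

Lemma farthest_ge (X : plane -> Prop) (p q : plane) :
  bounded_set X -> X p -> X q -> euclid_dist p q <= farthest X p.
Proof.
intros hX hp hq; apply (proj1 (farthest_lub X p hX hp)); now exists q.
Qed.

Lemma farthest_le (X : plane -> Prop) (p : plane) (r : R) :
  bounded_set X -> X p -> (forall q, X q -> euclid_dist p q <= r) ->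
  farthest X p <= r.
Proof.
intros hX hp h; apply (proj2 (farthest_lub X p hX hp) (Finite r)).
intros s [q [hq ->]]; simpl; auto.
Qed.

Lemma delta_glb (X : plane -> Prop) : bounded_set X -> (exists p, X p) ->
  is_glb_Rbar (fun r => exists p, X p /\ r = farthest X p) (delta X).
Proof.
intros hX [p hp].
assert (h := Glb_Rbar_correct (fun r => exists p, X p /\ r = farthest X p)).
change (delta X) with
  (real (Glb_Rbar (fun r => exists p, X p /\ r = farthest X p))).
destruct (Glb_Rbar _) as [r| |]; simpl; auto; exfalso.
- apply (proj1 h (farthest X p)); now exists p.
- apply (proj2 h (Finite 0)); intros r [q [hq ->]]; simpl.
  apply Rle_trans with (euclid_dist q q);
    [apply euclid_dist_nonneg | now apply farthest_ge].
Qed.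

(** The substitute [p'] is chosen before [q], so the supremum seen from [p'] exceeds the one seen
    from [p] by at most [c]; the infimum over [p] inherits this. The lower bound uses it with
    [c = 0], the upper bound with the roles of curve and polygon exchanged. *)
Lemma delta_le_shift (X Y : plane -> Prop) (c : R) :
  bounded_set X -> bounded_set Y -> (exists p, X p) ->
  (forall p, X p -> exists p', Y p' /\ forall q, Y q ->
     exists q', X q' /\ euclid_dist p' q <= euclid_dist p q' + c) ->
  delta Y <= delta X + c.
Proof.
intros hX hY [p0 hp0] h.
assert (hYne : exists p, Y p).
{ destruct (h p0 hp0) as [p' [hp' _]]; now exists p'. }
assert (hle : delta Y - c <= delta X); [|lra].
apply (proj2 (delta_glb X hX (ex_intro _ p0 hp0)) (Finite (delta Y - c))).
intros r [p [hp ->]]; simpl.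
destruct (h p hp) as [p' [hp' hq]].
assert (h1 : delta Y <= farthest Y p').
{ apply (proj1 (delta_glb Y hY hYne)); now exists p'. }
assert (h2 : farthest Y p' <= farthest X p + c); [|lra].
apply farthest_le; auto; intros q hYq.
destruct (hq q hYq) as [q' [hq' hd]].
assert (h3 := farthest_ge X p q' hX hp hq'); lra.
Qed.

(** * The curve lies to the left of its tangents *)

Definition dot (u v : plane) : R := fst u * fst v + snd u * snd v.

(* The barycentric coordinates of [p] are proportional to these three cross
   products, and their positivity is an open condition. *)
Lemma triangle_interior (A : plane -> Prop) (a b c p : plane) :
  convex_set A -> A a -> A b -> A c ->
  0 < cross (minus a p) (minus b p) -> 0 < cross (minus b p) (minus c p) ->
  0 < cross (minus c p) (minus a p) -> interior_set A p.
Proof.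
intros hA ha hb hc hab hbc hca.
assert (hin : forall q : plane, 0 < cross (minus a q) (minus b q) ->
  0 < cross (minus b q) (minus c q) -> 0 < cross (minus c q) (minus a q) ->
  A q).
{ clear p hab hbc hca; destruct a as [a1 a2], b as [b1 b2], c as [c1 c2].
  intros [q1 q2] h1 h2 h3.
  set (a := (a1, a2) : plane) in *; set (b := (b1, b2) : plane) in *.
  set (c := (c1, c2) : plane) in *; set (q := (q1, q2) : plane) in *.
  set (w := cross (minus a q) (minus b q)) in *.
  set (u := cross (minus b q) (minus c q)) in *.
  set (v := cross (minus c q) (minus a q)) in *.
  (* [m] is the point where the line from [c] through [q] meets the side from [a] to [b]; two uses
     of convexity then reach [q]. *)
  set (m := plus (scal (1 - v / (u + v)) a) (scal (v / (u + v)) b) : plane).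
  assert (hm : A m).
  { apply (hA a b ha hb); exists (v / (u + v)); split; [|reflexivity].
    split; [apply Rdiv_le_0_compat; lra|].
    apply Rle_div_l; lra. }
  apply (hA m c hm hc); exists (w / (u + v + w)); split.
  - split; [apply Rdiv_le_0_compat; lra | apply Rle_div_l; lra].
  - assert (hs : u + v <> 0) by lra. assert (ht : u + v + w <> 0) by lra.
    assert (e1 : q1 * (u + v + w) = a1 * u + b1 * v + c1 * w).
    { unfold u, v, w, cross, minus, plus, opp; simpl;
        unfold plus, opp; simpl; ring. }
    assert (e2 : q2 * (u + v + w) = a2 * u + b2 * v + c2 * w).
    { unfold u, v, w, cross, minus, plus, opp; simpl;
        unfold plus, opp; simpl; ring. }
    apply injective_projections; unfold m, plus, scal; simpl;
      unfold plus, scal, mult; simpl; unfold mult; simpl;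
      apply (Rmult_eq_reg_r (u + v + w)); auto;
      [apply (eq_trans e1) | apply (eq_trans e2)]; field; auto. }
assert (hopen : forall r s : plane, 0 < cross (minus r p) (minus s p) ->
  locally p (fun q => 0 < cross (minus r q) (minus s q))).
{ intros r s hrs.
  assert (hcont : continuous (fun q : plane =>
     (fst r - fst q) * (snd s - snd q) - (snd r - snd q) * (fst s - fst q)) p).
  { apply (continuous_minus (V := R_NormedModule));
      apply (continuous_mult (K := R_AbsRing));
      apply (continuous_minus (V := R_NormedModule));
      try apply continuous_const; [apply continuous_fst | apply continuous_snd
      | apply continuous_snd | apply continuous_fst]. }
  apply (hcont (fun z => 0 < z)).
  apply (open_gt 0), hrs. }
generalize (filter_and _ _ (hopen _ _ hab)
  (filter_and _ _ (hopen _ _ hbc) (hopen _ _ hca))).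
unfold interior_set; apply filter_imp; intros q [h1 [h2 h3]]; auto.
Qed.

(** The open sets of points farther than [/ (INR i + 1)] from [p] cover [A]; a finite subcover
    leaves a disc around [p] disjoint from [A]. *)
Lemma compact_set_closed (A : plane -> Prop) (p : plane) :
  compact_set A -> ~ A p -> interior_set (fun q => ~ A q) p.
Proof.
intros hA hp.
assert (hd : forall q, continuous (fun q : plane => euclid_dist q p) q).
{ intros q; apply (continuous_comp (fun q : plane => minus q p) norm).
  - apply (continuous_minus (V := plane));
      [apply continuous_id | apply continuous_const].
  - exact (filterlim_norm _). }
destruct (hA nat (fun i q => / (INR i + 1) < euclid_dist q p)) as [l hl].
{ intros i q hq. apply (hd q (fun z => / (INR i + 1) < z)).
  apply open_gt, hq. }
{ intros q hq.
  assert (hqp : 0 < euclid_dist q p).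
  { destruct (euclid_dist_nonneg q p) as [h|h]; auto; exfalso; apply hp.
    now rewrite <- (euclid_dist_eq0 q p (eq_sym h)). }
  destruct (archimed_cor1 _ hqp) as [N [h1 h2]]; exists N.
  apply Rle_lt_trans with (2 := h1), Rinv_le_contravar; [|lra].
  now apply lt_0_INR. }
assert (hN : exists N, forall i, List.In i l -> (i <= N)%nat).
{ clear; induction l as [|j l [N IH]]; [exists O; intros i []|].
  exists (Nat.max j N); intros i [->|h]; [lia|]. specialize (IH i h); lia. }
destruct hN as [N hN].
assert (hloc : locally p (fun q => euclid_dist q p < / (INR N + 1))).
{ apply (hd p (fun z => z < / (INR N + 1))), (open_lt (/ (INR N + 1))).
  rewrite euclid_distE, !Rminus_diag.
  replace (0 ^ 2 + 0 ^ 2) with 0 by ring; rewrite sqrt_0.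
  apply Rinv_0_lt_compat; assert (h := pos_INR N); lra. }
revert hloc; unfold interior_set; apply filter_imp; intros q hq hAq.
destruct (hl q hAq) as [i [hi hiq]].
assert (hiN := le_INR _ _ (hN i hi)); assert (h0 := pos_INR i).
assert (h : / (INR N + 1) <= / (INR i + 1)); [|lra].
apply Rinv_le_contravar; lra.
Qed.

(** * Coordinate identities and derivatives along the curve *)

Ltac plane_unfold :=
  unfold cross, dot, left_normal, minus, plus, opp, scal, mult, zero; simpl;
  unfold cross, dot, left_normal, minus, plus, opp, scal, mult, zero; simpl;
  unfold cross, dot, left_normal, minus, plus, opp, scal, mult, zero; simpl.

Ltac as_real_eq := match goal with |- @eq _ ?a ?b => change (@eq R a b) end.

Ltac plane_ring := plane_unfold; as_real_eq; ring.

Lemma C2_curve_derive (g : R -> plane) (t : R) : C2_curve g ->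
  (is_derive (fun u => fst (g u)) t (fst (velocity g t)) /\
   is_derive (fun u => snd (g u)) t (snd (velocity g t))) /\
  (is_derive (fun u => fst (velocity g u)) t (fst (acceleration g t)) /\
   is_derive (fun u => snd (velocity g u)) t (snd (acceleration g t))).
Proof.
intros [h _].
destruct (h t 1%nat ltac:(lia)) as [h1 h2].
destruct (h t 2%nat ltac:(lia)) as [h3 h4].
repeat split; apply Derive_correct; assumption.
Qed.

Lemma is_derive_lincomb (a b c t x' y' : R) (x y : R -> R) :
  is_derive x t x' -> is_derive y t y' ->
  is_derive (fun u => a * x u + b * y u + c) t (a * x' + b * y').
Proof.
intros hx hy.
replace (a * x' + b * y') with (plus (plus (a * x') (b * y')) 0)
  by (unfold plus; simpl; ring).
apply (is_derive_plus (V := R_NormedModule)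
  (fun u => a * x u + b * y u) (fun _ => c)); 
  [|exact (is_derive_const (V := R_NormedModule) c t)].
apply (is_derive_plus (V := R_NormedModule)
  (fun u => a * x u) (fun u => b * y u)); now apply is_derive_scal.
Qed.

Lemma is_derive_cross_curve (g : R -> plane) (p q : plane) (t : R) :
  C2_curve g ->
  is_derive (fun u => cross q (minus (g u) p)) t (cross q (velocity g t)).
Proof.
intros h; destruct (proj1 (C2_curve_derive g t h)) as [hx hy].
assert (hd := is_derive_lincomb (- snd q) (fst q)
  (- cross q p) t _ _ _ _ hx hy).
replace (cross q (velocity g t)) with
  (- snd q * fst (velocity g t) + fst q * snd (velocity g t))
  by (plane_ring).
revert hd; apply is_derive_ext; intros u; plane_ring.
Qed.

Lemma is_derive_dot_curve (g : R -> plane) (p q : plane) (t : R) :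
  C2_curve g ->
  is_derive (fun u => dot q (minus (g u) p)) t (dot q (velocity g t)).
Proof.
intros h; destruct (proj1 (C2_curve_derive g t h)) as [hx hy].
assert (hd := is_derive_lincomb (fst q) (snd q)
  (- dot q p) t _ _ _ _ hx hy).
revert hd; apply is_derive_ext; intros u; plane_ring.
Qed.

Lemma is_derive_cross_velocity (g : R -> plane) (q : plane) (t : R) :
  C2_curve g ->
  is_derive (fun u => cross q (velocity g u)) t (cross q (acceleration g t)).
Proof.
intros h; destruct (proj2 (C2_curve_derive g t h)) as [hx hy].
assert (hd := is_derive_lincomb (- snd q) (fst q) 0 t _ _ _ _ hx hy).
replace (cross q (acceleration g t)) with
  (- snd q * fst (acceleration g t) + fst q * snd (acceleration g t))
  by (plane_ring).
revert hd; apply is_derive_ext; intros u; plane_ring.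
Qed.

Lemma is_derive_dot_velocity (g : R -> plane) (q : plane) (t : R) :
  C2_curve g ->
  is_derive (fun u => dot q (velocity g u)) t (dot q (acceleration g t)).
Proof.
intros h; destruct (proj2 (C2_curve_derive g t h)) as [hx hy].
assert (hd := is_derive_lincomb (fst q) (snd q) 0 t _ _ _ _ hx hy).
revert hd; apply is_derive_ext; intros u; plane_ring.
Qed.

Lemma continuous_curve (g : R -> plane) (t : R) :
  C2_curve g -> continuous g t.
Proof.
intros h; destruct (proj1 (C2_curve_derive g t h)) as [hx hy].
assert (cx := ex_derive_continuous (V := R_NormedModule) _ _
  (ex_intro _ _ hx)).
assert (cy := ex_derive_continuous (V := R_NormedModule) _ _
  (ex_intro _ _ hy)).
intros P [e he].
assert (lx := cx _ (locally_ball (fst (g t)) e)).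
assert (ly := cy _ (locally_ball (snd (g t)) e)).
generalize (filter_and (F := locally t) (fun u => ball (fst (g t)) e (fst (g u)))
  (fun u => ball (snd (g t)) e (snd (g u))) lx ly).
unfold filtermap; apply filter_imp; intros u hu; apply he, hu.
Qed.

Lemma is_derive_continuity_pt (f : R -> R) (t d : R) :
  is_derive f t d -> continuity_pt f t.
Proof.
intros h; apply continuity_pt_filterlim.
apply (ex_derive_continuous (V := R_NormedModule) f t); now exists d.
Qed.

Lemma derive_pos_sign (f : R -> R) (t d : R) :
  is_derive f t d -> 0 < d -> f t = 0 ->
  exists e, 0 < e /\ forall h, 0 < h < e -> 0 < f (t + h) /\ f (t - h) < 0.
Proof.
intros hd d0 h0; apply is_derive_Reals in hd.
(* With the derivative [d] itself as tolerance, the difference quotient stays positive on both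
   sides. *)
destruct (hd d d0) as [e he]; exists e; split; [apply cond_pos|].
intros h hh.
assert (h1 := he h ltac:(lra) ltac:(rewrite Rabs_pos_eq; lra)).
assert (h2 := he (- h) ltac:(lra) ltac:(rewrite Rabs_left; lra)).
rewrite h0 in h1, h2; apply Rabs_def2 in h1, h2; split.
- replace (f (t + h)) with ((f (t + h) - 0) / h * h) by (field; lra).
  apply Rmult_lt_0_compat; lra.
- replace (f (t - h)) with (- ((f (t + - h) - 0) / - h * h))
    by (change (t - h) with (t + - h); field; lra).
  apply Ropp_lt_gt_0_contravar, Rmult_lt_0_compat; lra.
Qed.

Lemma dot_self_pos (v : plane) : v <> zero -> 0 < dot v v.
Proof.
intros hv; destruct (Rle_lt_dec (dot v v) 0) as [h|]; auto; exfalso; apply hv.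
destruct (Rplus_sqr_eq_0 (fst v) (snd v)).
{ unfold Rsqr; unfold dot in h.
  assert (h1 := Rle_0_sqr (fst v)); assert (h2 := Rle_0_sqr (snd v)).
  unfold Rsqr in h1, h2; apply Rle_antisym; [exact h|].
  now apply Rplus_le_le_0_compat. }
now apply injective_projections.
Qed.

Lemma cross_minus_self (v p : plane) : cross v (minus p p) = 0.
Proof. plane_ring. Qed.

Lemma dot_minus_self (v p : plane) : dot v (minus p p) = 0.
Proof. plane_ring. Qed.

(* Points of [A] on the wrong side of the tangent line put [g t] inside a
   triangle whose other vertices are on the inner normal and on the curve. *)
Lemma tangent_oblique (A : plane -> Prop) (g : R -> plane) (t s : R)
    (q : plane) :
  C2_curve g -> velocity g t <> zero -> convex_set A ->
  ~ interior_set A (g t) -> (forall u, A (g u)) ->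
  0 < s -> A (plus (g t) (scal s (left_normal g t))) -> A q ->
  dot (velocity g t) (minus q (g t)) <> 0 ->
  0 <= cross (velocity g t) (minus q (g t)).
Proof.
intros hC hv hA hint hg s0 ha hq hdot; apply Rnot_lt_le; intros hneg.
apply hint; clear hint.
set (v := velocity g t) in *; set (N := left_normal g t) in *.
set (a := plus (g t) (scal s N) : plane) in *.
assert (hvv := dot_self_pos v hv).
assert (hav : forall r : plane, cross (minus a (g t)) r = - s * cross r N).
{ intros r; unfold a; plane_ring. }
assert (hva : cross N v = - dot v v).
{ unfold N, v; plane_ring. }
assert (hNr : forall r, cross r N = dot v r).
{ intros r; unfold N, v; plane_ring. }
assert (hsym : forall r r' : plane, cross r r' = - cross r' r).
{ intros r r'; plane_ring. }
destruct (derive_pos_sign (fun u => cross (opp N) (minus (g u) (g t))) t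
  (cross (opp N) v)) as [e1 [he1 h1]].
{ now apply is_derive_cross_curve. }
{ replace (cross (opp N) v) with (- cross N v) by (plane_ring); lra. }
{ apply cross_minus_self. }
destruct (derive_pos_sign (fun u => cross (minus q (g t)) (minus (g u) (g t)))
  t (cross (minus q (g t)) v)) as [e2 [he2 h2]].
{ now apply is_derive_cross_curve. }
{ rewrite hsym; lra. }
{ apply cross_minus_self. }
set (h := Rmin e1 e2 / 2).
assert (hh : 0 < h < e1 /\ 0 < h < e2).
{ unfold h; assert (x1 := Rmin_l e1 e2); assert (x2 := Rmin_r e1 e2).
  assert (0 < Rmin e1 e2) by (apply Rmin_pos; auto). lra. }
destruct (h1 h (proj1 hh)) as [k1 k2]; destruct (h2 h (proj2 hh)) as [k3 k4].
assert (hoN : forall r : plane, cross (opp N) r = cross r N).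
{ intros r; plane_ring. }
rewrite hoN in k1, k2.
(* The third vertex is taken across the normal from [q]: just ahead of [g t] if [q] lies behind,
   just behind it otherwise. *)
destruct (Rdichotomy _ _ hdot) as [hd|hd].
- apply (triangle_interior A a q (g (t + h))); auto.
  + rewrite hav, hNr; nra.
  + rewrite hsym, hav; nra.
- apply (triangle_interior A a (g (t - h)) q); auto.
  + rewrite hav; nra.
  + rewrite hsym; lra.
  + rewrite hsym, hav, hNr; nra.
Qed.

Lemma boundary_in_compact (A : plane -> Prop) (p : plane) :
  compact_set A -> boundary A p -> A p.
Proof.
intros hA [_ h]; apply NNPP; intros hp; apply h.
now apply compact_set_closed.
Qed.

Lemma curve_in_domain (g : R -> plane) (T : R) (Omega : plane -> Prop) (t : R) :
  strictly_convex_C2_curve g T Omega -> Omega (g t).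
Proof.
intros hg; apply boundary_in_compact; [apply (domain_compact _ _ _ hg)|].
apply (curve_bounds _ _ _ hg); now exists t.
Qed.

Lemma tangent_supports (g : R -> plane) (T : R) (Omega : plane -> Prop)
    (t : R) (q : plane) :
  strictly_convex_C2_curve g T Omega -> Omega q ->
  0 <= cross (velocity g t) (minus q (g t)).
Proof.
intros hg hq.
assert (hC := curve_C2 _ _ _ hg); assert (hv := curve_regular _ _ _ hg t).
assert (hin := fun u => curve_in_domain _ _ _ u hg).
destruct (curve_domain_left _ _ _ hg t) as [e [he hN]].
assert (hob : forall r, Omega r -> dot (velocity g t) (minus r (g t)) <> 0 ->
  0 <= cross (velocity g t) (minus r (g t))).
{ intros r hr; apply (tangent_oblique Omega g t (e / 2)); auto.
  - apply (domain_convex _ _ _ hg).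
  - apply (proj1 (curve_bounds _ _ _ hg (g t))); now exists t.
  - lra.
  - apply hN; lra. }
destruct (Req_dec (dot (velocity g t) (minus q (g t))) 0) as [h0|h0]; auto.
apply Rnot_lt_le; intros hneg.
(* When [q - g t] is normal to the curve, moving [q] towards a nearby point of
   the curve reduces to the oblique case. *)
set (v := velocity g t) in *.
destruct (derive_pos_sign (fun u => dot v (minus (g u) (g t))) t (dot v v))
  as [e1 [he1 h1]].
{ now apply is_derive_dot_curve. }
{ now apply dot_self_pos. }
{ apply dot_minus_self. }
assert (hc := ex_derive_continuous (V := R_NormedModule) _ _
  (ex_intro _ _ (is_derive_cross_curve g (g t) v t hC))).
assert (hlt : locally (cross v (minus (g t) (g t)))
  (fun z => z < - cross v (minus q (g t)))).
{ apply (open_lt (- cross v (minus q (g t)))).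
  rewrite cross_minus_self.
  now apply Ropp_0_gt_lt_contravar. }
destruct (hc _ hlt) as [e2 h2].
set (h := Rmin e1 e2 / 2).
assert (hh : 0 < h < e1 /\ 0 < h < e2).
{ unfold h; assert (x1 := Rmin_l e1 e2); assert (x2 := Rmin_r e1 e2).
  assert (0 < Rmin e1 e2) by (apply Rmin_pos; auto; apply cond_pos). lra. }
assert (k1 := proj1 (h1 h (proj1 hh))).
assert (k2 : cross v (minus (g (t + h)) (g t)) < - cross v (minus q (g t))).
{ apply h2. change (Rabs (t + h - t) < e2).
  rewrite Rabs_pos_eq; lra. }
set (m := plus (scal (1 - 1 / 2) q) (scal (1 / 2) (g (t + h))) : plane).
assert (hm : Omega m).
{ apply (domain_convex _ _ _ hg q (g (t + h)) hq (hin _)).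
  exists (1 / 2); split; [lra|reflexivity]. }
assert (hcm : cross v (minus m (g t)) =
  / 2 * (cross v (minus q (g t)) + cross v (minus (g (t + h)) (g t)))).
{ unfold m; plane_unfold; as_real_eq; field. }
assert (hdm : dot v (minus m (g t)) =
  / 2 * (dot v (minus q (g t)) + dot v (minus (g (t + h)) (g t)))).
{ unfold m; plane_unfold; as_real_eq; field. }
assert (hfin := hob m hm ltac:(lra)); lra.
Qed.

(** The chord from [g t] to [g u] would lie in [Omega] and on a supporting line, so none of its
    points is interior. It is then part of the boundary, and strict convexity collapses it to a
    point. *)
Lemma tangent_meets_once (g : R -> plane) (T : R) (Omega : plane -> Prop)
    (t u : R) :
  strictly_convex_C2_curve g T Omega ->
  cross (velocity g t) (minus (g u) (g t)) = 0 -> g t = g u.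
Proof.
intros hg h0; apply (curve_strictly_convex _ _ _ hg); intros r hr.
assert (hOr : Omega r).
{ apply (domain_convex _ _ _ hg (g t) (g u)); auto;
    now apply (curve_in_domain g T). }
apply (curve_bounds _ _ _ hg); split.
- intros [e he].
  assert (hv := dot_self_pos _ (curve_regular _ _ _ hg t)).
  set (v := velocity g t) in *.
  destruct hr as [s [_ hr]].
  assert (hr0 : cross v (minus r (g t)) = 0).
  { rewrite hr; transitivity (s * cross v (minus (g u) (g t)));
      [plane_ring | rewrite h0; ring]. }
  (* [M] strictly exceeds both coordinates of [v], so moving [r] by [e / M] times the right normal
     stays in the ball but leaves the supporting half plane. *)
  set (M := 1 + Rabs (fst v) + Rabs (snd v)).
  assert (hM : 0 < M /\ Rabs (fst v) < M /\ Rabs (snd v) < M).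
  { unfold M; assert (x1 := Rabs_pos (fst v));
    assert (x2 := Rabs_pos (snd v)); lra. }
  assert (he0 := cond_pos e); set (c := pos e / M).
  assert (hc : 0 < c) by (apply Rdiv_lt_0_compat; lra).
  assert (hsmall : forall y, Rabs y < M -> Rabs (c * y) < e).
  { intros y hy; rewrite Rabs_mult, (Rabs_pos_eq c) by lra.
    apply Rlt_le_trans with (c * M); [now apply Rmult_lt_compat_l|].
    right; unfold c; field; lra. }
  assert (hq := he (fst r + c * snd v, snd r - c * fst v)).
  assert (hneg := tangent_supports g T Omega t
    (fst r + c * snd v, snd r - c * fst v) hg).
  assert (hcr : cross v
    (minus ((fst r + c * snd v, snd r - c * fst v) : plane) (g t)) =
    cross v (minus r (g t)) - c * dot v v) by plane_ring.
  fold v in hneg; rewrite hcr, hr0 in hneg.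
  assert (0 < c * dot v v) by now apply Rmult_lt_0_compat.
  enough (0 <= 0 - c * dot v v) by lra.
  apply hneg, hq; split; simpl.
  + change (Rabs (fst r + c * snd v - fst r) < e).
    replace (fst r + c * snd v - fst r) with (c * snd v) by ring.
    now apply hsmall.
  + change (Rabs (snd r - c * fst v - snd r) < e).
    replace (snd r - c * fst v - snd r) with (- (c * fst v)) by ring.
    rewrite Rabs_Ropp; now apply hsmall.
- intros [e he]; apply (he r); [apply ball_center | exact hOr].
Qed.

(** * Periodicity, injectivity and cyclic order on the curve *)

Lemma periodic_IZR (g : R -> plane) (T : R) :
  (forall t, g (t + T) = g t) -> forall z t, g (t + IZR z * T) = g t.
Proof.
intros h.
assert (hn : forall n t, g (t + INR n * T) = g t).
{ induction n as [|n IH]; intros t; [f_equal; simpl; ring|].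
  replace (t + INR (S n) * T) with (t + INR n * T + T)
    by (rewrite S_INR; ring).
  now rewrite h. }
intros z t; destruct (Z.le_gt_cases 0 z) as [hz|hz].
- rewrite <- (Z2Nat.id z hz), <- INR_IZR_INZ; apply hn.
- rewrite <- (hn (Z.to_nat (- z)) (t + IZR z * T)), INR_IZR_INZ, Z2Nat.id by lia.
  rewrite opp_IZR; f_equal; ring.
Qed.

Lemma period_reduction (T s a : R) : 0 < T ->
  exists z, a <= s + IZR z * T < a + T.
Proof.
intros hT; exists (- Int_part ((s - a) / T))%Z; rewrite opp_IZR.
destruct (base_Int_part ((s - a) / T)) as [h1 h2].
set (z := IZR (Int_part ((s - a) / T))) in *.
assert (e : (s - a) / T * T = s - a) by (field; lra).
assert (k1 : z * T <= (s - a) / T * T) by (apply Rmult_le_compat_r; lra).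
assert (k2 : ((s - a) / T) * T < (z + 1) * T)
  by (apply Rmult_lt_compat_r; lra).
lra.
Qed.

Lemma curve_injective (g : R -> plane) (T : R) (Omega : plane -> Prop)
    (s u : R) :
  strictly_convex_C2_curve g T Omega -> s < u < s + T -> g s <> g u.
Proof.
intros hg hsu heq.
assert (hT := curve_period_pos _ _ _ hg).
assert (hp := periodic_IZR g T (curve_periodic _ _ _ hg)).
destruct (period_reduction T s 0 hT) as [m hm].
destruct (period_reduction T u 0 hT) as [n hn].
assert (h : s + IZR m * T = u + IZR n * T).
{ apply (curve_simple _ _ _ hg); try lra; now rewrite !hp. }
assert (h1 : u - s = IZR (m - n) * T) by (rewrite minus_IZR; lra).
assert (h2 : (0 < m - n)%Z) by (apply lt_IZR; nra).
assert (h3 : 1 <= IZR (m - n)) by (apply IZR_le; lia).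
nra.
Qed.

Lemma tangent_strict (g : R -> plane) (T : R) (Omega : plane -> Prop)
    (s u : R) :
  strictly_convex_C2_curve g T Omega -> s < u < s + T ->
  0 < cross (velocity g s) (minus (g u) (g s)) /\
  0 < cross (velocity g u) (minus (g s) (g u)).
Proof.
intros hg hsu.
assert (hne := curve_injective g T Omega s u hg hsu).
assert (hs := curve_in_domain g T Omega s hg).
assert (hu := curve_in_domain g T Omega u hg).
destruct (tangent_supports g T Omega s (g u) hg hu) as [h1|h1];
destruct (tangent_supports g T Omega u (g s) hg hs) as [h2|h2]; auto;
  exfalso; apply hne; first [now apply (tangent_meets_once g T Omega) |
    symmetry; now apply (tangent_meets_once g T Omega)].
Qed.

(* The cotangent of the angle between [velocity g s] and [g t - g s] decreases
   with [t]. *)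
Lemma curve_orientation (g : R -> plane) (T : R) (Omega : plane -> Prop)
    (s t u : R) :
  strictly_convex_C2_curve g T Omega -> s < t < u -> u < s + T ->
  0 < cross (minus (g t) (g s)) (minus (g u) (g s)).
Proof.
intros hg hstu hu.
assert (hC := curve_C2 _ _ _ hg).
set (e := velocity g s).
set (X := fun t => dot e (minus (g t) (g s))).
set (Y := fun t => cross e (minus (g t) (g s))).
assert (hee := dot_self_pos _ (curve_regular _ _ _ hg s)); fold e in hee.
assert (hY : forall r, s < r < s + T -> 0 < Y r).
{ intros r hr; apply (tangent_strict g T Omega s r hg hr). }
destruct (MVT_gen (fun r => X r / Y r) t u (fun r =>
  (dot e (velocity g r) * Y r - X r * cross e (velocity g r)) / Y r ^ 2))
  as [c [hc hmvt]].
{ rewrite Rmin_left, Rmax_right by lra; intros r hr.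
  apply (is_derive_div X Y).
  - now apply is_derive_dot_curve.
  - now apply is_derive_cross_curve.
  - apply Rgt_not_eq, hY; lra. }
{ rewrite Rmin_left, Rmax_right by lra; intros r hr.
  eapply is_derive_continuity_pt, (is_derive_div X Y r _ _
    (is_derive_dot_curve g (g s) e r hC) (is_derive_cross_curve g (g s) e r hC)),
    Rgt_not_eq, hY; lra. }
rewrite Rmin_left, Rmax_right in hc by lra.
assert (hcT := proj2 (tangent_strict g T Omega s c hg ltac:(lra))).
(* In the frame of [e], the numerator of the derivative of [X / Y] is a cross product of velocity
   and position; its sign is the support condition of the tangent at [c]. *)
assert (hnum : dot e (velocity g c) * Y c - X c * cross e (velocity g c) =
  - (dot e e * cross (velocity g c) (minus (g s) (g c)))).
{ unfold X, Y; generalize (velocity g c); intros w; plane_ring. }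
rewrite hnum in hmvt.
assert (hYc := hY c ltac:(lra)); assert (hYt := hY t ltac:(lra)).
assert (hYu := hY u ltac:(lra)).
assert (hneg : X u / Y u - X t / Y t < 0).
{ rewrite hmvt, Rdiv_opp_l, <- Ropp_mult_distr_l.
  apply Ropp_lt_gt_0_contravar, Rmult_lt_0_compat; [|lra].
  apply Rdiv_lt_0_compat; [now apply Rmult_lt_0_compat | now apply pow_lt]. }
assert (hid : dot e e * cross (minus (g t) (g s)) (minus (g u) (g s)) =
  X t * Y u - X u * Y t).
{ unfold X, Y; generalize e; intros w; plane_ring. }
assert (hpos : 0 < X t * Y u - X u * Y t).
{ replace (X t * Y u - X u * Y t) with
    (- (X u / Y u - X t / Y t) * (Y u * Y t)) by (field; lra).
  apply Rmult_lt_0_compat; [lra | now apply Rmult_lt_0_compat]. }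
rewrite <- hid in hpos; nra.
Qed.

(** Otherwise the velocity would turn right just after [t] and carry the curve across its tangent at
    [g t], against strict support. *)
Lemma curvature_numerator_nonneg (g : R -> plane) (T : R)
    (Omega : plane -> Prop) (t : R) :
  strictly_convex_C2_curve g T Omega ->
  0 <= cross (velocity g t) (acceleration g t).
Proof.
intros hg; apply Rnot_lt_le; intros hneg.
assert (hC := curve_C2 _ _ _ hg).
set (v := velocity g t) in *.
assert (hT := curve_period_pos _ _ _ hg).
destruct (derive_pos_sign (fun u => cross (opp v) (velocity g u)) t
  (cross (opp v) (acceleration g t))) as [e [he h]].
{ now apply is_derive_cross_velocity. }
{ replace (cross (opp v) (acceleration g t)) with
    (- cross v (acceleration g t)) by (generalize (acceleration g t);
     generalize v; intros ? ?; plane_ring); lra. }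
{ fold v; generalize v; intros w; plane_ring. }
assert (hmin : 0 < Rmin e T) by now apply Rmin_pos.
assert (hl := Rmin_l e T); assert (hr := Rmin_r e T).
set (r := t + Rmin e T / 2).
destruct (MVT_gen (fun u => cross v (minus (g u) (g t))) t r
  (fun u => cross v (velocity g u))) as [c [hc hmvt]].
{ intros u _; now apply is_derive_cross_curve. }
{ intros u _; eapply is_derive_continuity_pt, is_derive_cross_curve, hC. }
unfold r in hc; rewrite Rmin_left, Rmax_right in hc by lra.
assert (hpos := proj1 (tangent_strict g T Omega t r hg
  ltac:(unfold r; lra))); fold v in hpos.
rewrite cross_minus_self, Rminus_0_r in hmvt; rewrite hmvt in hpos.
assert (hle : cross v (velocity g c) <= 0).
{ destruct (Rle_lt_or_eq_dec t c (proj1 hc)) as [htc| <-].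
  - assert (k := proj1 (h (c - t) ltac:(lra))).
    replace (t + (c - t)) with c in k by ring.
    replace (cross (opp v) (velocity g c)) with (- cross v (velocity g c)) in k
      by (generalize (velocity g c); generalize v; intros ? ?; plane_ring).
    lra.
  - fold v; right; unfold cross; ring. }
assert (hrt : 0 < r - t) by (unfold r; lra). nra.
Qed.

(** * Projection onto the edges *)

Lemma dot_self_nonneg (v : plane) : 0 <= dot v v.
Proof.
assert (h1 := Rle_0_sqr (fst v)); assert (h2 := Rle_0_sqr (snd v)).
now apply Rplus_le_le_0_compat.
Qed.

Lemma segment_left (a b : plane) : segment a b a.
Proof.
exists 0; split; [lra|]; apply injective_projections; plane_ring.
Qed.

Lemma segment_right (a b : plane) : segment a b b.
Proof.
exists 1; split; [lra|]; apply injective_projections; plane_ring.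
Qed.

(** The nearest point has parameter [m / D] clamped to [[0, 1]], and the inequality is its
    variational characterization. The case [m <= 0] comes first and absorbs the degenerate edge
    [a = b]. *)
Lemma segment_projection (a b p : plane) : exists p', segment a b p' /\
  forall x, segment a b x -> dot (minus x p') (minus p p') <= 0.
Proof.
set (D := dot (minus b a) (minus b a)).
set (m := dot (minus p a) (minus b a)).
assert (hD : 0 <= D) by apply dot_self_nonneg.
assert (key : forall s, 0 <= s <= 1 ->
  (forall r, 0 <= r <= 1 -> (r - s) * (m - s * D) <= 0) ->
  exists p', segment a b p' /\
  forall x, segment a b x -> dot (minus x p') (minus p p') <= 0).
{ intros s hs h; exists (plus (scal (1 - s) a) (scal s b)).
  split; [now exists s|]; intros x [r [hr ->]].
  apply Rle_trans with (2 := h r hr); right; unfold m, D; plane_ring. }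
destruct (Rle_lt_dec m 0) as [h1|h1].
{ apply (key 0); [lra|]; intros r hr; nra. }
destruct (Rle_lt_dec D m) as [h2|h2].
{ apply (key 1); [lra|]; intros r hr; nra. }
apply (key (m / D)).
- split; [apply Rdiv_le_0_compat; lra | apply Rle_div_l; lra].
- intros r _; replace (m - m / D * D) with 0 by (field; lra); lra.
Qed.

(** Since [w] is positive, the inequality at the crossing point passes on to [q]:
    [dot (minus q p') (minus p p')] is at most 0. The angle at [p'] is then not acute and faces the
    longest side. *)
Lemma projection_closer (p p' q : plane) (w : R) : 0 < w <= 1 ->
  dot (minus (plus (scal (1 - w) p) (scal w q)) p') (minus p p') <= 0 ->
  euclid_dist p' q <= euclid_dist p q.
Proof.
intros hw h; apply euclid_dist_mono.
assert (e1 : dot (minus (plus (scal (1 - w) p) (scal w q)) p') (minus p p') =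
  (1 - w) * dot (minus p p') (minus p p') + w * dot (minus q p') (minus p p'))
  by plane_ring.
assert (hn := dot_self_nonneg (minus p p')).
assert (e2 : (fst p - fst q) ^ 2 + (snd p - snd q) ^ 2 =
  (fst p' - fst q) ^ 2 + (snd p' - snd q) ^ 2 +
  (dot (minus p p') (minus p p') - 2 * dot (minus q p') (minus p p')))
  by plane_ring.
rewrite e2, e1 in *; nra.
Qed.

(** Squared distance is convex along a segment, the defect being the term in [D]. Distances to the
    polygon are thereby controlled by distances to its vertices. *)
Lemma dist_segment_le (p a b q : plane) : segment a b q ->
  euclid_dist p q <= euclid_dist p a \/ euclid_dist p q <= euclid_dist p b.
Proof.
intros [s [hs ->]].
set (A := (fst p - fst a) ^ 2 + (snd p - snd a) ^ 2).
set (B := (fst p - fst b) ^ 2 + (snd p - snd b) ^ 2).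
set (D := dot (minus b a) (minus b a)).
assert (hD : 0 <= D) by apply dot_self_nonneg.
set (q := plus (scal (1 - s) a) (scal s b) : plane).
assert (e : (fst p - fst q) ^ 2 + (snd p - snd q) ^ 2 =
  (1 - s) * A + s * B - s * (1 - s) * D)
  by (unfold q, A, B, D; plane_ring).
assert (hsD : 0 <= s * (1 - s) * D)
  by (apply Rmult_le_pos; [apply Rmult_le_pos|]; lra).
destruct (Rle_lt_dec A B) as [h|h]; [right|left];
  apply euclid_dist_mono; rewrite e; [fold B | fold A]; nra.
Qed.

(** Either diagonal cuts the quadrilateral [a p b q] into two triangles, so [pbq + apq] and
    [apb + abq] are the same doubled area. The ratios of these areas are the parameters of the
    crossing point on both diagonals. *)
Lemma diagonals_cross (a p b q : plane) :
  0 < cross (minus p a) (minus b a) -> 0 < cross (minus b a) (minus q a) ->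
  0 <= cross (minus b p) (minus q p) -> 0 <= cross (minus p a) (minus q a) ->
  exists w, 0 < w <= 1 /\ segment a b (plus (scal (1 - w) p) (scal w q)).
Proof.
set (apb := cross (minus p a) (minus b a)).
set (abq := cross (minus b a) (minus q a)).
set (pbq := cross (minus b p) (minus q p)).
set (apq := cross (minus p a) (minus q a)).
intros h1 h2 h3 h4.
assert (e : pbq + apq = apb + abq)
  by (unfold apb, abq, pbq, apq; plane_ring).
exists (apb / (apb + abq)); split.
{ split; [apply Rdiv_lt_0_compat; lra | apply Rle_div_l; lra]. }
exists (apq / (apb + abq)); split.
{ split; [apply Rdiv_le_0_compat; lra | apply Rle_div_l; lra]. }
assert (hs : apb + abq <> 0) by lra.
assert (w1 : 1 - apb / (apb + abq) = abq / (apb + abq)) by (field; lra).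
assert (w2 : 1 - apq / (apb + abq) = pbq / (apb + abq))
  by (rewrite <- e; field; lra).
rewrite w1, w2; unfold Rdiv; set (i := / (apb + abq)).
apply injective_projections; unfold apb, abq, pbq, apq; plane_ring.
Qed.

Lemma edge_projection (g : R -> plane) (T : R) (Omega : plane -> Prop)
    (a s b : R) :
  strictly_convex_C2_curve g T Omega -> a < s < b -> b < a + T ->
  exists p', segment (g a) (g b) p' /\
    forall r, b <= r <= a + T -> euclid_dist p' (g r) <= euclid_dist (g s) (g r).
Proof.
intros hg hs hb.
destruct (segment_projection (g a) (g b) (g s)) as [p' [hp' h]].
exists p'; split; auto; intros r hr.
assert (hx : exists w, 0 < w <= 1 /\
  segment (g a) (g b) (plus (scal (1 - w) (g s)) (scal w (g r)))).
{ assert (hone : forall q : plane, plus (scal (1 - 1) (g s)) (scal 1 q) = q).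
  { intros q; apply injective_projections; plane_ring. }
  (* If [g r] is an end of the edge, the area [abq] vanishes; [w = 1] takes that end itself as the
     crossing point. *)
  destruct (Req_dec r b) as [->|hrb].
  { exists 1; split; [lra|]; rewrite hone; apply segment_right. }
  destruct (Req_dec r (a + T)) as [->|hra].
  { exists 1; split; [lra|]; rewrite hone, (curve_periodic _ _ _ hg).
    apply segment_left. }
  apply diagonals_cross; try apply Rlt_le;
    apply (curve_orientation g T Omega); auto; lra. }
destruct hx as [w [hw hx]].
apply (projection_closer (g s) p' (g r) w hw), h, hx.
Qed.

(** * Vertices, arcs and the lower bound *)

Lemma inscribed_le (T : R) (n : nat) (t : nat -> R) (i j : nat) :
  inscribed T n t -> (i <= j <= n)%nat -> t i <= t j.
Proof.
intros [_ [h _]] [hij hj]; induction hij as [|j hij IH]; [lra|].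
assert (h1 := h j ltac:(lia)); assert (h2 := IH ltac:(lia)); lra.
Qed.

(** Another edge uses up a positive part of the period. Strictness keeps the two ends of an edge
    distinct on the curve, as [edge_projection] requires. *)
Lemma inscribed_edge_short (T : R) (n : nat) (t : nat -> R) (i : nat) :
  inscribed T n t -> (i < n)%nat -> t (S i) < t i + T.
Proof.
intros ht hi; assert (ht' := ht); destruct ht' as [hn [h hT]].
destruct i as [|i].
- assert (h1 := h 1%nat ltac:(lia)).
  assert (h2 := inscribed_le T n t 2 n ht ltac:(lia)); lra.
- assert (h1 := h 0%nat ltac:(lia)).
  assert (h2 := inscribed_le T n t 1 (S i) ht ltac:(lia)).
  assert (h3 := inscribed_le T n t (S (S i)) n ht ltac:(lia)); lra.
Qed.

Lemma locate_step (t : nat -> R) (n : nat) (s : R) :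
  t O <= s < t n -> exists i, (i < n)%nat /\ t i <= s < t (S i).
Proof.
induction n as [|n IH]; intros hs; [lra|].
destruct (Rle_lt_dec (t n) s) as [h|h].
- exists n; split; [lia|lra].
- destruct IH as [i [hi h']]; [lra|]; exists i; split; [lia|lra].
Qed.

Lemma trace_on_arc (g : R -> plane) (T : R) (Omega : plane -> Prop) (n : nat)
    (t : nat -> R) (p : plane) :
  strictly_convex_C2_curve g T Omega -> inscribed T n t -> trace g p ->
  exists i s, (i < n)%nat /\ t i <= s < t (S i) /\ p = g s.
Proof.
intros hg [_ [_ hT]] [s0 ->].
destruct (period_reduction T s0 (t O) (curve_period_pos _ _ _ hg)) as [z hz].
destruct (locate_step t n (s0 + IZR z * T)) as [i [hi hs]]; [lra|].
exists i, (s0 + IZR z * T); repeat split; auto; try apply hs.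
symmetry; apply periodic_IZR, (curve_periodic _ _ _ hg).
Qed.

Lemma polygon_projection (g : R -> plane) (T : R) (Omega : plane -> Prop)
    (n : nat) (t : nat -> R) (p : plane) :
  strictly_convex_C2_curve g T Omega -> inscribed T n t -> trace g p ->
  exists p', polygon n (fun i => g (t i)) p' /\
    forall j, (j <= n)%nat -> euclid_dist p' (g (t j)) <= euclid_dist p (g (t j)).
Proof.
intros hg ht hp.
destruct (trace_on_arc g T Omega n t p hg ht hp) as [i [s [hi [hs ->]]]].
destruct (Req_dec s (t i)) as [->|hne].
{ exists (g (t i)); split; [exists i; split; [auto|apply segment_left]|].
  intros; apply Rle_refl. }
destruct (edge_projection g T Omega (t i) s (t (S i)) hg) as [p' [hp' h]].
{ lra. }
{ now apply (inscribed_edge_short T n). }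
exists p'; split; [now exists i|]; intros j hj.
assert (hT := proj2 (proj2 ht)).
(* The comparison holds for parameters in [[t (S i), t i + T]]; vertices up to index [i] get there
   after one period. *)
destruct (Nat.le_gt_cases j i) as [hji|hji].
- rewrite <- (curve_periodic _ _ _ hg (t j)); apply h.
  assert (h1 := inscribed_le T n t j i ht ltac:(lia)).
  assert (h2 := inscribed_le T n t 0 j ht ltac:(lia)).
  assert (h3 := inscribed_le T n t (S i) n ht ltac:(lia)); lra.
- apply h.
  assert (h1 := inscribed_le T n t 0 i ht ltac:(lia)).
  assert (h2 := inscribed_le T n t (S i) j ht ltac:(lia)).
  assert (h3 := inscribed_le T n t j n ht ltac:(lia)); lra.
Qed.

Lemma curve_bounded (g : R -> plane) (T : R) (Omega : plane -> Prop) :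
  strictly_convex_C2_curve g T Omega -> bounded_set (trace g).
Proof.
intros hg; assert (hT := curve_period_pos _ _ _ hg).
destruct (bounded_continuity g 0 T) as [M hM].
{ intros s _; apply continuous_curve, (curve_C2 _ _ _ hg). }
exists (M + M); intros p q [s ->] [u ->].
assert (hb : forall r, norm (g r) <= M).
{ intros r; destruct (period_reduction T r 0 hT) as [z hz].
  rewrite <- (periodic_IZR g T (curve_periodic _ _ _ hg) z r).
  apply Rlt_le, hM; lra. }
unfold euclid_dist.
apply Rle_trans with (norm (g s) + norm (opp (g u)));
  [apply (norm_triangle (g s) (opp (g u)))|].
rewrite norm_opp; apply Rplus_le_compat; apply hb.
Qed.

Lemma polygon_bounded (g : R -> plane) (n : nat) (t : nat -> R) :
  bounded_set (trace g) -> bounded_set (polygon n (fun i => g (t i))).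
Proof.
intros [M hM]; exists M; intros p q [i [_ hp]] [j [_ hq]].
assert (h : forall u, trace g u -> euclid_dist u q <= M).
{ intros u hu; destruct (dist_segment_le u _ _ q hq) as [h|h];
    apply (Rle_trans _ _ _ h), hM; auto; eexists; reflexivity. }
rewrite euclid_dist_sym.
destruct (dist_segment_le q _ _ p hp) as [h'|h'];
  apply (Rle_trans _ _ _ h'); rewrite euclid_dist_sym; apply h;
  eexists; reflexivity.
Qed.

Lemma delta_polygon_le (g : R -> plane) (T : R) (Omega : plane -> Prop)
    (n : nat) (t : nat -> R) :
  strictly_convex_C2_curve g T Omega -> inscribed T n t ->
  delta (polygon n (fun i => g (t i))) <= delta (trace g).
Proof.
intros hg ht; assert (hb := curve_bounded g T Omega hg).
rewrite <- (Rplus_0_r (delta (trace g))); apply delta_le_shift; auto.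
{ now apply polygon_bounded. }
{ now exists (g 0), 0. }
intros p hp.
destruct (polygon_projection g T Omega n t p hg ht hp) as [p' [hp' h]].
exists p'; split; auto; intros q [i [hi hq]].
destruct (dist_segment_le p' _ _ q hq) as [hd|hd]; eexists;
  (split; [eexists; reflexivity|]); rewrite Rplus_0_r;
  apply (Rle_trans _ _ _ hd), h; lia.
Qed.

(** * Turning of the tangent *)

Lemma mean_value (f f' : R -> R) (a b : R) :
  (forall t, is_derive f t (f' t)) ->
  exists c, Rmin a b <= c <= Rmax a b /\ f b - f a = f' c * (b - a).
Proof.
intros h; apply MVT_gen; intros x _; [apply h|].
eapply is_derive_continuity_pt, h.
Qed.

Lemma nondecreasing_of_derive (f f' : R -> R) (a b : R) :
  (forall t, is_derive f t (f' t)) -> a <= b ->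
  (forall t, a <= t <= b -> 0 <= f' t) -> f a <= f b.
Proof.
intros h hab h0; destruct (mean_value f f' a b h) as [c [hc e]].
rewrite Rmin_left, Rmax_right in hc by lra.
assert (0 <= f' c * (b - a)) by (apply Rmult_le_pos; [auto|lra]); lra.
Qed.

Lemma constant_of_derive (f : R -> R) (a b : R) :
  (forall t, is_derive f t 0) -> f a = f b.
Proof.
intros h; destruct (mean_value f (fun _ => 0) a b h) as [c [_ e]]; lra.
Qed.

Lemma is_derive_primitive (f : R -> R) (a t : R) :
  (forall s, continuous f s) -> is_derive (fun s => RInt f a s) t (f t).
Proof.
intros h; apply (is_derive_RInt (V := R_NormedModule) f _ a t); [|apply h].
apply filter_forall; intros s.
apply (RInt_correct (V := R_CompleteNormedModule)).
apply (ex_RInt_continuous (V := R_CompleteNormedModule)); auto.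
Qed.

(** The quotient is the first coordinate of the vector [(X, Y)] turned back by the angle [w] and
    rescaled by [S]. The second coordinate arises from the pair [(Y, - X)]. *)
Lemma is_derive_rotated_quotient (X Y S w : R -> R) (t X' Y' S' w' : R) :
  is_derive X t X' -> is_derive Y t Y' -> is_derive S t S' ->
  is_derive w t w' -> S t <> 0 ->
  is_derive (fun s => (X s * cos (w s) + Y s * sin (w s)) / S s) t
    (((X' + w' * Y t) * cos (w t) + (Y' - w' * X t) * sin (w t)) / S t -
     (X t * cos (w t) + Y t * sin (w t)) * S' / S t ^ 2).
Proof.
intros hX hY hS hw h0; auto_derive.
- repeat split; auto; eexists; eassumption.
- rewrite (is_derive_unique (fun s : R => X s) _ _ hX),
    (is_derive_unique (fun s : R => Y s) _ _ hY),
    (is_derive_unique (fun s : R => S s) _ _ hS),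
    (is_derive_unique (fun s : R => w s) _ _ hw).
  field; auto.
Qed.

(** * Speed, turning rate and the rotation of the velocity *)

Definition speed (g : R -> plane) (t : R) : R := norm (velocity g t).

(** The derivative of the tangent angle with respect to the parameter, that is, curvature times
    speed. *)
Definition turning_rate (g : R -> plane) (t : R) : R :=
  cross (velocity g t) (acceleration g t) / speed g t ^ 2.

Lemma speed_sqr (g : R -> plane) (t : R) :
  speed g t ^ 2 = dot (velocity g t) (velocity g t).
Proof.
unfold speed; rewrite norm_planeE, pow2_sqrt.
- unfold dot; ring.
- apply Rplus_le_le_0_compat; apply pow2_ge_0.
Qed.

Lemma speed_pos (g : R -> plane) (t : R) :
  velocity g t <> zero -> 0 < speed g t.
Proof.
intros hv; unfold speed; apply Rnot_le_lt; intros h; apply hv.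
apply (norm_eq_zero (V := plane)), Rle_antisym; [exact h | apply norm_ge_0].
Qed.

Lemma is_derive_hypot (x y : R -> R) (t x' y' : R) :
  is_derive x t x' -> is_derive y t y' -> 0 < x t ^ 2 + y t ^ 2 ->
  is_derive (fun s => sqrt (x s ^ 2 + y s ^ 2)) t
    ((x t * x' + y t * y') / sqrt (x t ^ 2 + y t ^ 2)).
Proof.
intros hx hy h0; auto_derive.
- repeat split; auto; eexists; eassumption.
- rewrite (is_derive_unique (fun s : R => x s) _ _ hx),
    (is_derive_unique (fun s : R => y s) _ _ hy).
  change (x t * (x t * 1) + y t * (y t * 1)) with (x t ^ 2 + y t ^ 2).
  field; apply Rgt_not_eq, sqrt_lt_R0, h0.
Qed.

Lemma is_derive_speed (g : R -> plane) (t : R) :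
  C2_curve g -> velocity g t <> zero ->
  is_derive (speed g) t
    (dot (velocity g t) (acceleration g t) / speed g t).
Proof.
intros hC hv; destruct (proj2 (C2_curve_derive g t hC)) as [hx hy].
unfold speed at 2; rewrite norm_planeE.
apply is_derive_ext with (f := fun u => sqrt
  (fst (velocity g u) ^ 2 + snd (velocity g u) ^ 2)).
{ intros u; symmetry; apply norm_planeE. }
apply is_derive_hypot; auto.
assert (h := dot_self_pos _ hv); unfold dot in h; lra.
Qed.

Lemma continuous_turning_rate (g : R -> plane) (t : R) :
  C2_curve g -> velocity g t <> zero -> continuous (turning_rate g) t.
Proof.
intros hC hv; destruct (proj2 (C2_curve_derive g t hC)) as [hx hy].
assert (hs := speed_pos g t hv).
assert (ha := proj2 hC t).
assert (cx := ex_derive_continuous (V := R_NormedModule) _ _ (ex_intro _ _ hx)).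
assert (cy := ex_derive_continuous (V := R_NormedModule) _ _ (ex_intro _ _ hy)).
assert (cax : continuous (fun u => fst (acceleration g u)) t).
{ apply (continuous_comp (acceleration g) (fun p : plane => fst p)); auto.
  apply continuous_fst. }
assert (cay : continuous (fun u => snd (acceleration g u)) t).
{ apply (continuous_comp (acceleration g) (fun p : plane => snd p)); auto.
  apply continuous_snd. }
assert (cs := ex_derive_continuous (V := R_NormedModule) _ _
  (ex_intro _ _ (is_derive_speed g t hC hv))).
apply (continuous_mult (K := R_AbsRing)
  (fun u => cross (velocity g u) (acceleration g u))
  (fun u => / speed g u ^ 2)).
- apply (continuous_minus (V := R_NormedModule)
    (fun u => fst (velocity g u) * snd (acceleration g u))
    (fun u => snd (velocity g u) * fst (acceleration g u)));
    now apply (continuous_mult (K := R_AbsRing)).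
- apply (continuous_comp (fun u => speed g u ^ 2) Rinv).
  + apply (continuous_mult (K := R_AbsRing) (speed g)
      (fun u => speed g u * 1)); auto.
    apply (continuous_mult (K := R_AbsRing) (speed g) (fun _ => 1)); auto.
    apply continuous_const.
  + apply continuous_Rinv, Rgt_not_eq, pow_lt, hs.
Qed.

(** Turned back by [w] and divided by its speed, the velocity has derivative zero, so it keeps its
    direction at [a]: [hF] and [hG] are its two coordinates, scaled by [speed g a]. Inverting the
    rotation gives both formulas. *)
Lemma velocity_rotation (g : R -> plane) (a t : R) :
  C2_curve g -> (forall s, velocity g s <> zero) ->
  let w := RInt (turning_rate g) a t in
  dot (velocity g a) (velocity g t) = speed g a * speed g t * cos w /\
  cross (velocity g a) (velocity g t) = speed g a * speed g t * sin w.
Proof.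
intros hC hv; set (u := velocity g a).
set (w := fun s => RInt (turning_rate g) a s).
set (X := fun s => dot u (velocity g s)).
set (Y := fun s => cross u (velocity g s)).
assert (hw : forall s, is_derive w s (turning_rate g s)).
{ intros s; apply is_derive_primitive; intros r.
  now apply continuous_turning_rate. }
assert (w0 : w a = 0) by apply (RInt_point (V := R_CompleteNormedModule)).
assert (hS : forall s, 0 < speed g s) by (intros s; now apply speed_pos).
assert (hX : forall s, is_derive X s (dot u (acceleration g s)))
  by (intros s; now apply is_derive_dot_velocity).
assert (hY : forall s, is_derive Y s (cross u (acceleration g s)))
  by (intros s; now apply is_derive_cross_velocity).
(* The acceleration is (S'/S) times the velocity plus [turning_rate] times its
   rotation by a right angle. *)
assert (hXY : forall s, dot u (acceleration g s) + turning_rate g s * Y s =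
    dot (velocity g s) (acceleration g s) / speed g s ^ 2 * X s /\
  cross u (acceleration g s) - turning_rate g s * X s =
    dot (velocity g s) (acceleration g s) / speed g s ^ 2 * Y s).
{ intros s; assert (h0 := hS s); unfold turning_rate, X, Y.
  split; apply (Rmult_eq_reg_r (speed g s ^ 2));
    try (apply pow_nonzero; lra); field_simplify; try lra;
    rewrite speed_sqr; unfold dot, cross; ring. }
assert (hF : forall s,
  (X s * cos (w s) + Y s * sin (w s)) / speed g s = speed g a).
{ intros s; rewrite <- (constant_of_derive
    (fun s => (X s * cos (w s) + Y s * sin (w s)) / speed g s) a s).
  - rewrite w0, cos_0, sin_0; unfold X.
    assert (h0 := hS a); assert (e := speed_sqr g a); fold u in e |- *.
    rewrite <- e; field; lra.
  - intros r; assert (h0 := hS r).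
    assert (hd := is_derive_rotated_quotient X Y (speed g) w r _ _ _ _ (hX r)
      (hY r) (is_derive_speed g r hC (hv r)) (hw r) (Rgt_not_eq _ _ h0)).
    rewrite (proj1 (hXY r)), (proj2 (hXY r)) in hd.
    refine (eq_ind _ (is_derive _ r) hd _ _); as_real_eq; field; lra. }
assert (hG : forall s,
  (Y s * cos (w s) + - X s * sin (w s)) / speed g s = 0).
{ intros s; rewrite <- (constant_of_derive
    (fun s => (Y s * cos (w s) + - X s * sin (w s)) / speed g s) a s).
  - rewrite w0, cos_0, sin_0; unfold Y.
    assert (h0 := hS a); fold u; unfold cross; field; lra.
  - intros r; assert (h0 := hS r).
    assert (hnX := is_derive_opp (V := R_NormedModule) _ _ _ (hX r)).
    assert (hd := is_derive_rotated_quotient Y (fun s => - X s) (speed g) w r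
      _ _ _ _ (hY r) hnX (is_derive_speed g r hC (hv r)) (hw r)
      (Rgt_not_eq _ _ h0)).
    refine (eq_ind _ (is_derive _ r) hd _ _).
    unfold opp; simpl.
    replace (cross u (acceleration g r) + turning_rate g r * - X r) with
      (cross u (acceleration g r) - turning_rate g r * X r) by ring.
    replace (- dot u (acceleration g r) - turning_rate g r * Y r) with
      (- (dot u (acceleration g r) + turning_rate g r * Y r)) by ring.
    rewrite (proj1 (hXY r)), (proj2 (hXY r)); as_real_eq; field; lra. }
intros w'; change w' with (w t); clear w'.
assert (h0 := hS t); assert (f := hF t); assert (f' := hG t).
assert (k1 : X t * cos (w t) + Y t * sin (w t) = speed g a * speed g t)
  by (rewrite <- f; field; lra).
assert (k2 : Y t * cos (w t) + - X t * sin (w t) = 0).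
{ apply (Rmult_eq_reg_r (/ speed g t)).
  - rewrite Rmult_0_l; exact f'.
  - apply Rinv_neq_0_compat; lra. }
assert (cs := sin2_cos2 (w t)); unfold Rsqr in cs.
change (X t = speed g a * speed g t * cos (w t) /\
  Y t = speed g a * speed g t * sin (w t)).
rewrite <- k1; split.
- transitivity (X t * (sin (w t) * sin (w t) + cos (w t) * cos (w t)) +
    sin (w t) * (Y t * cos (w t) + - X t * sin (w t)));
    [rewrite cs, k2|]; ring.
- transitivity (Y t * (sin (w t) * sin (w t) + cos (w t) * cos (w t)) -
    cos (w t) * (Y t * cos (w t) + - X t * sin (w t)));
    [rewrite cs, k2|]; ring.
Qed.

Lemma is_derive_arclength (g : R -> plane) (a t : R) :
  C2_curve g -> (forall s, velocity g s <> zero) ->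
  is_derive (arclength g a) t (speed g t).
Proof.
intros hC hv; apply (is_derive_primitive (speed g)); intros s.
apply (ex_derive_continuous (V := R_NormedModule)).
eexists; now apply is_derive_speed.
Qed.

Lemma turning_rate_le (g : R -> plane) (t k : R) :
  velocity g t <> zero -> curvature g t <= k ->
  turning_rate g t <= k * speed g t.
Proof.
intros hv hk; assert (hs := speed_pos g t hv).
replace (turning_rate g t) with (curvature g t * speed g t)
  by (unfold curvature, turning_rate; fold (speed g t); field; lra).
apply Rmult_le_compat_r; lra.
Qed.

(** Both [w] and [k * L - w] are nondecreasing, so the turning between two parameters is at most [k]
    times the arclength between them. The base point [c] is arbitrary on the arc because it will be
    where the tangent is parallel to the chord. *)
Lemma turning_angle_bound (g : R -> plane) (a b c t k lambda : R) :
  C2_curve g -> (forall s, velocity g s <> zero) ->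
  (forall s, 0 <= cross (velocity g s) (acceleration g s)) ->
  (forall s, curvature g s <= k) -> 0 < k ->
  a <= c <= b -> a <= t <= b -> arclength g a b <= lambda ->
  Rabs (RInt (turning_rate g) c t) <= k * lambda.
Proof.
intros hC hv h0 hk k0 hc ht hl.
set (w := fun s => RInt (turning_rate g) c s).
set (L := arclength g a).
assert (hw : forall s, is_derive w s (turning_rate g s)).
{ intros s; apply is_derive_primitive; intros r.
  now apply continuous_turning_rate. }
assert (hL : forall s, is_derive L s (speed g s))
  by (intros s; now apply is_derive_arclength).
assert (w0 : w c = 0) by apply (RInt_point (V := R_CompleteNormedModule)).
assert (L0 : L a = 0) by apply (RInt_point (V := R_CompleteNormedModule)).
assert (hS : forall s, 0 < speed g s) by (intros s; now apply speed_pos).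
assert (hr : forall s, 0 <= turning_rate g s <= k * speed g s).
{ intros s; split; [|now apply turning_rate_le].
  apply Rdiv_le_0_compat; [apply h0 | apply pow_lt, hS]. }
assert (mL : forall r s, r <= s -> L r <= L s).
{ intros r s hrs; apply (nondecreasing_of_derive L (speed g)); auto.
  intros u _; apply Rlt_le, hS. }
assert (mw : forall r s, r <= s -> w r <= w s).
{ intros r s hrs; apply (nondecreasing_of_derive w (turning_rate g)); auto.
  intros u _; apply hr. }
assert (mkw : forall r s, r <= s -> k * L r - w r <= k * L s - w s).
{ intros r s hrs; apply (nondecreasing_of_derive (fun u => k * L u - w u)
    (fun u => k * speed g u - turning_rate g u)); auto.
  - intros u; apply (is_derive_minus (V := R_NormedModule)
      (fun u => k * L u) w); auto; apply is_derive_scal, hL.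
  - intros u _; assert (x := hr u); lra. }
change (Rabs (w t) <= k * lambda).
change (L b <= lambda) in hl.
assert (l1 := mL a c (proj1 hc)); assert (l2 := mL c b (proj2 hc)).
assert (l3 := mL a t (proj1 ht)); assert (l4 := mL t b (proj2 ht)).
apply Rabs_le; destruct (Rle_lt_dec c t) as [hct|hct].
- assert (x1 := mw c t hct); assert (x2 := mkw c t hct); nra.
- assert (x1 := mw t c ltac:(lra)); assert (x2 := mkw t c ltac:(lra)); nra.
Qed.

(** Multiplied by [cos m], the two inequalities say that [sin (m + x)] and [sin (m - x)] are
    nonnegative; both angles lie between 0 and [PI]. *)
Lemma abs_sin_le_tan (x m : R) : Rabs x <= m -> m < PI / 2 ->
  Rabs (sin x) <= tan m * cos x.
Proof.
intros hx hm.
assert (hx' := proj1 (Rabs_le_between _ _) hx).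
assert (hc : 0 < cos m) by (apply cos_gt_0; lra).
assert (h1 : 0 <= sin (m + x)) by (apply sin_ge_0; lra).
assert (h2 : 0 <= sin (m - x)) by (apply sin_ge_0; lra).
rewrite sin_plus in h1; rewrite sin_minus in h2.
assert (e : tan m * cos x = sin m * cos x / cos m)
  by (unfold tan; field; lra).
rewrite e; apply Rabs_le; split.
- apply Ropp_le_cancel; rewrite Ropp_involutive.
  apply Rle_div_r; [exact hc|]; lra.
- apply Rle_div_r; [exact hc|]; lra.
Qed.

(* [u] is the unit tangent at a point where the tangent is parallel to the
   chord; [dot u] and [cross u] are the coordinates along the chord and across
   it. *)
Lemma arc_over_chord (g : R -> plane) (a b k lambda : R) :
  C2_curve g -> (forall s, velocity g s <> zero) ->
  (forall s, 0 <= cross (velocity g s) (acceleration g s)) ->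
  (forall s, curvature g s <= k) -> 0 < k -> k * lambda < PI / 2 ->
  a < b -> arclength g a b <= lambda ->
  exists u, dot u u = 1 /\ cross u (minus (g b) (g a)) = 0 /\
    0 < dot u (minus (g b) (g a)) /\
    forall t, a <= t <= b ->
      0 <= dot u (minus (g t) (g a)) <= dot u (minus (g b) (g a)) /\
      Rabs (cross u (minus (g t) (g a))) <= lambda * tan (k * lambda) / 2.
Proof.
intros hC hv h0 hk k0 hkl hab hl.
set (q := minus (g b) (g a) : plane).
(* The height over the chord vanishes at both ends, so by Rolle's argument some velocity is parallel
   to [q]. *)
destruct (mean_value (fun s => cross q (minus (g s) (g a)))
  (fun s => cross q (velocity g s)) a b) as [c [hc e]].
{ intros s; now apply is_derive_cross_curve. }
rewrite Rmin_left, Rmax_right in hc by lra.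
rewrite cross_minus_self in e.
assert (ec : cross q (velocity g c) = 0).
{ apply (Rmult_eq_reg_r (b - a)); [|lra]; rewrite <- e; fold q.
  unfold cross; ring. }
assert (hS : forall s, 0 < speed g s) by (intros s; now apply speed_pos).
assert (hSc := hS c).
set (u := scal (/ speed g c) (velocity g c) : plane).
assert (hdu : forall v, dot u v = / speed g c * dot (velocity g c) v).
{ intros v; unfold u; generalize (velocity g c); intros w; plane_ring. }
assert (hcu : forall v, cross u v = / speed g c * cross (velocity g c) v).
{ intros v; unfold u; generalize (velocity g c); intros w; plane_ring. }
assert (huu : dot u u = 1).
{ rewrite hdu.
  replace (dot (velocity g c) u) with (dot u (velocity g c))
    by (unfold dot; ring).
  rewrite hdu, <- speed_sqr; field; lra. }
set (w := fun s => RInt (turning_rate g) c s).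
assert (hv1 : forall s, dot u (velocity g s) = speed g s * cos (w s) /\
  cross u (velocity g s) = speed g s * sin (w s)).
{ intros s; destruct (velocity_rotation g c s hC hv) as [e1 e2].
  rewrite hdu, hcu, e1, e2; fold (w s); split; field; lra. }
assert (hw : forall s, a <= s <= b -> Rabs (w s) <= k * lambda).
{ intros s hs; now apply (turning_angle_bound g a b). }
assert (hcos : forall s, a <= s <= b -> 0 < cos (w s)).
{ intros s hs; assert (x := proj1 (Rabs_le_between _ _) (hw s hs)).
  apply cos_gt_0; lra. }
set (D := fun s => dot u (minus (g s) (g a))).
set (H := fun s => cross u (minus (g s) (g a))).
set (L := arclength g a).
assert (dD : forall s, is_derive D s (speed g s * cos (w s))).
{ intros s; rewrite <- (proj1 (hv1 s)); now apply is_derive_dot_curve. }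
assert (dH : forall s, is_derive H s (speed g s * sin (w s))).
{ intros s; rewrite <- (proj2 (hv1 s)); now apply is_derive_cross_curve. }
assert (dL : forall s, is_derive L s (speed g s))
  by (intros s; now apply is_derive_arclength).
assert (D0 : D a = 0) by apply dot_minus_self.
assert (H0 : H a = 0) by apply cross_minus_self.
assert (L0 : L a = 0) by apply (RInt_point (V := R_CompleteNormedModule)).
assert (H1 : H b = 0).
{ unfold H; rewrite hcu; fold q.
  replace (cross (velocity g c) q) with (- cross q (velocity g c))
    by (unfold cross; ring).
  rewrite ec; ring. }
assert (mD : forall r s, a <= r -> r <= s -> s <= b -> D r <= D s).
{ intros r s h1 h2 h3; apply (nondecreasing_of_derive D
    (fun s => speed g s * cos (w s))); auto; intros t ht.
  apply Rmult_le_pos; apply Rlt_le; [apply hS | apply hcos; lra]. }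
(* The slope bound in integrated form, for both signs of the height; dividing by the derivative of
   [D] is avoided. *)
assert (mtan : forall sgn, sgn = 1 \/ sgn = -1 ->
  forall r s, a <= r -> r <= s -> s <= b ->
  tan (k * lambda) * D r + sgn * H r <= tan (k * lambda) * D s + sgn * H s).
{ intros sgn hsgn r s h1 h2 h3; apply (nondecreasing_of_derive
    (fun s => tan (k * lambda) * D s + sgn * H s) (fun s =>
     tan (k * lambda) * (speed g s * cos (w s)) +
     sgn * (speed g s * sin (w s)))); auto.
  - intros t; apply (is_derive_plus (V := R_NormedModule)
      (fun s => tan (k * lambda) * D s) (fun s => sgn * H s));
      now apply is_derive_scal.
  - intros t ht.
    assert (x := abs_sin_le_tan _ _ (hw t ltac:(lra)) hkl).
    apply Rabs_le_between in x.
    replace (tan (k * lambda) * (speed g t * cos (w t)) +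
      sgn * (speed g t * sin (w t))) with
      (speed g t * (tan (k * lambda) * cos (w t) + sgn * sin (w t))) by ring.
    apply Rmult_le_pos; [apply Rlt_le, hS|]; destruct hsgn as [->| ->]; lra. }
assert (hDb : D b <= lambda).
{ assert (x : L a - D a <= L b - D b).
  { apply (nondecreasing_of_derive (fun s => L s - D s)
      (fun s => speed g s - speed g s * cos (w s))); [|lra|].
    - intros t; now apply (is_derive_minus (V := R_NormedModule) L D).
    - intros t _; assert (x := COS_bound (w t)); assert (y := hS t); nra. }
  change (L b <= lambda) in hl; lra. }
assert (hDb0 : 0 < D b).
{ destruct (mean_value D (fun s => speed g s * cos (w s)) a b dD)
    as [x [hx ex]].
  rewrite Rmin_left, Rmax_right in hx by lra.
  rewrite D0, Rminus_0_r in ex; rewrite ex.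
  repeat apply Rmult_lt_0_compat; [apply hS | now apply hcos | lra]. }
assert (htan : 0 <= tan (k * lambda)).
{ assert (x := mtan 1 (or_introl eq_refl) a b ltac:(lra) ltac:(lra) ltac:(lra)).
  rewrite D0, H0, H1 in x; nra. }
exists u; split; [exact huu|]; split; [exact H1|]; split; [exact hDb0|].
intros t ht; split.
{ change (0 <= D t <= D b); rewrite <- D0; split; apply mD; lra. }
change (Rabs (H t) <= lambda * tan (k * lambda) / 2).
(* The height is bounded from each end of the chord, by the slope times [D t] and times [D b - D t].
   Averaging the two bounds gives the factor one half. *)
assert (x1 := mtan 1 (or_introl eq_refl) a t ltac:(lra) ltac:(lra) ltac:(lra)).
assert (x2 := mtan 1 (or_introl eq_refl) t b ltac:(lra) ltac:(lra) ltac:(lra)).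
assert (x3 := mtan (-1) (or_intror eq_refl) a t
  ltac:(lra) ltac:(lra) ltac:(lra)).
assert (x4 := mtan (-1) (or_intror eq_refl) t b
  ltac:(lra) ltac:(lra) ltac:(lra)).
rewrite D0, H0 in x1, x3; rewrite H1 in x2, x4.
assert (x5 : tan (k * lambda) * D b <= lambda * tan (k * lambda)) by nra.
apply Rabs_le; lra.
Qed.

(** * Passing between arc and chord, and the upper bound *)

Lemma euclid_dist_frame (u p q : plane) (r : R) : dot u u = 1 ->
  dot u (minus p q) = 0 -> Rabs (cross u (minus p q)) <= r ->
  euclid_dist p q <= r.
Proof.
intros hu hd hc.
assert (hr : 0 <= r) by (apply Rle_trans with (2 := hc), Rabs_pos).
apply euclid_dist_le; auto.
replace ((fst p - fst q) ^ 2 + (snd p - snd q) ^ 2) with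
  (dot (minus p q) (minus p q)) by plane_ring.
rewrite <- (Rmult_1_l (dot (minus p q) (minus p q))), <- hu.
replace (dot u u * dot (minus p q) (minus p q)) with
  (dot u (minus p q) ^ 2 + cross u (minus p q) ^ 2) by plane_ring.
rewrite hd, <- (pow2_abs (cross u (minus p q))).
assert (h := Rabs_pos (cross u (minus p q))); nra.
Qed.

Lemma arc_close_to_chord (g : R -> plane) (a b k lambda : R) :
  C2_curve g -> (forall s, velocity g s <> zero) ->
  (forall s, 0 <= cross (velocity g s) (acceleration g s)) ->
  (forall s, curvature g s <= k) -> 0 < k -> k * lambda < PI / 2 ->
  a < b -> arclength g a b <= lambda ->
  (forall t, a <= t <= b -> exists q, segment (g a) (g b) q /\
     euclid_dist (g t) q <= lambda * tan (k * lambda) / 2) /\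
  (forall q, segment (g a) (g b) q -> exists t,
     euclid_dist (g t) q <= lambda * tan (k * lambda) / 2).
Proof.
intros hC hv h0 hk k0 hkl hab hl.
destruct (arc_over_chord g a b k lambda) as [u [hu [hcb [hdb h]]]]; auto.
set (d := dot u (minus (g b) (g a))) in *.
assert (hfoot : forall t s, a <= t <= b ->
  dot u (minus (g t) (g a)) = s * d ->
  euclid_dist (g t) (plus (scal (1 - s) (g a)) (scal s (g b))) <=
    lambda * tan (k * lambda) / 2).
{ intros t s ht hs; apply (euclid_dist_frame u); auto.
  - transitivity (dot u (minus (g t) (g a)) - s * d); [|lra].
    unfold d; plane_ring.
  - replace (cross u (minus (g t) (plus (scal (1 - s) (g a)) (scal s (g b)))))
      with (cross u (minus (g t) (g a)) - s * cross u (minus (g b) (g a)))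
      by plane_ring.
    rewrite hcb, Rmult_0_r, Rminus_0_r; now apply h. }
split.
- intros t ht; destruct (h t ht) as [hd _].
  exists (plus (scal (1 - dot u (minus (g t) (g a)) / d) (g a))
    (scal (dot u (minus (g t) (g a)) / d) (g b))); split.
  + eexists; split; [|reflexivity].
    split; [apply Rdiv_le_0_compat | apply Rle_div_l]; lra.
  + apply hfoot; auto; field; lra.
- intros q [s [hs ->]].
  (* The coordinate along the chord runs continuously from 0 to [d], so every point of the chord
     faces a point of the arc. *)
  destruct (IVT_gen (fun t => dot u (minus (g t) (g a))) a b (s * d))
    as [t [ht et]].
  + intros t; eapply is_derive_continuity_pt; now apply is_derive_dot_curve.
  + rewrite dot_minus_self; fold d; rewrite Rmin_left, Rmax_right by lra; nra.
  + rewrite Rmin_left, Rmax_right in ht by lra.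
    exists t; now apply hfoot.
Qed.

(** The sign of [lambda] is forced by the first edge, whose arc has positive length; in the theorem
    this in turn forces [0 < k]. *)
Lemma arclength_bound_pos (g : R -> plane) (T : R) (n : nat) (t : nat -> R)
    (lambda : R) :
  C2_curve g -> (forall s, velocity g s <> zero) -> inscribed T n t ->
  arclength_bound g n t lambda -> 0 < lambda.
Proof.
intros hC hv [hn [ht _]] hl; apply Rlt_le_trans with (2 := hl O ltac:(lia)).
assert (h := ht O ltac:(lia)).
destruct (mean_value (arclength g (t O)) (speed g) (t O) (t 1%nat))
  as [c [_ e]].
{ intros s; now apply is_derive_arclength. }
assert (e0 : arclength g (t O) (t O) = 0)
  by apply (RInt_point (V := R_CompleteNormedModule)).
rewrite e0, Rminus_0_r in e; rewrite e.
apply Rmult_lt_0_compat; [now apply speed_pos | lra].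
Qed.

Lemma delta_curve_le (g : R -> plane) (T : R) (Omega : plane -> Prop)
    (k lambda : R) (n : nat) (t : nat -> R) :
  strictly_convex_C2_curve g T Omega -> (forall t, curvature g t <= k) ->
  0 < k -> k * lambda < PI / 2 -> inscribed T n t ->
  arclength_bound g n t lambda ->
  delta (trace g) <=
    delta (polygon n (fun i => g (t i))) + lambda * tan (k * lambda).
Proof.
intros hg hk k0 hkl ht hl.
assert (hC := curve_C2 _ _ _ hg); assert (hv := curve_regular _ _ _ hg).
assert (hcl : forall i, (i < n)%nat -> _) by
  (intros i hi; exact (arc_close_to_chord g (t i) (t (S i)) k lambda hC hv
    (fun s => curvature_numerator_nonneg g T Omega s hg) hk k0 hkl
    (proj1 (proj2 ht) i hi) (hl i hi))).
assert (hb := curve_bounded g T Omega hg).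
apply delta_le_shift; auto.
{ now apply polygon_bounded. }
{ exists (g (t O)), O; split; [destruct ht; lia | apply segment_left]. }
intros p [i [hi hp]].
destruct (proj2 (hcl i hi) p hp) as [s hs].
exists (g s); split; [now exists s|]; intros q hq.
destruct (trace_on_arc g T Omega n t q hg ht hq) as [j [r [hj [hr ->]]]].
destruct (proj1 (hcl j hj) r ltac:(lra)) as [q' [hq' hd]].
exists q'; split; [now exists j|].
assert (x1 := euclid_dist_triangle (g s) p (g r)).
assert (x2 := euclid_dist_triangle p q' (g r)).
rewrite (euclid_dist_sym q' (g r)) in x2; lra.
Qed.

(** * Quadratic error term *)

(** Up to [PI / 3] the cosine is at least one half, and the sine is at most [x]. *)
Lemma tan_le_double (x : R) : 0 <= x <= PI / 3 -> tan x <= 2 * x.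
Proof.
intros hx; assert (hpi := PI_RGT_0).
assert (hc : / 2 <= cos x).
{ replace (/ 2) with (cos (PI / 3)) by (rewrite cos_PI3; lra).
  apply cos_decr_1; lra. }
assert (hs : sin x <= x).
{ destruct (Req_dec x 0) as [->|]; [rewrite sin_0; lra|].
  apply Rlt_le, sin_lt_x; lra. }
unfold tan; apply Rle_div_l; [lra|]; nra.
Qed.

Lemma delta_polygon_quadratic_error (g : R -> plane) (T : R)
    (Omega : plane -> Prop) (k : R) :
  strictly_convex_C2_curve g T Omega -> (forall t, curvature g t <= k) ->
  exists C eta, 0 < C /\ 0 < eta /\
    forall (n : nat) (t : nat -> R) (lambda : R),
      inscribed T n t -> arclength_bound g n t lambda -> lambda < eta ->
      0 < lambda /\
      Rabs (delta (polygon n (fun i => g (t i))) - delta (trace g))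
        <= C * lambda ^ 2.
Proof.
intros hg hk; assert (hpi := PI_RGT_0).
assert (hC := curve_C2 _ _ _ hg); assert (hv := curve_regular _ _ _ hg).
(* [K] is a curvature bound that is positive by construction, whatever the sign of [k]. *)
set (K := Rmax k 1).
assert (hkK := Rmax_l k 1); assert (h1K := Rmax_r k 1); fold K in hkK, h1K.
(* [eta] ensures [K * lambda < PI / 3], where [tan (K * lambda)] is at most [2 * (K * lambda)]; a
   further factor [lambda] gives the constant [2 * K]. *)
exists (2 * K), (PI / (3 * K)); split; [lra|]; split.
{ apply Rdiv_lt_0_compat; lra. }
intros n t lambda ht hl heta.
assert (l0 := arclength_bound_pos g T n t lambda hC hv ht hl).
split; [exact l0|].
assert (hKl : K * lambda < PI / 3).
{ apply Rlt_le_trans with (K * (PI / (3 * K))).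
  - apply Rmult_lt_compat_l; lra.
  - right; field; lra. }
assert (hK : forall s, curvature g s <= K)
  by (intros s; apply Rle_trans with (2 := hkK), hk).
assert (x1 := delta_polygon_le g T Omega n t hg ht).
assert (x2 := delta_curve_le g T Omega K lambda n t hg hK
  ltac:(lra) ltac:(lra) ht hl).
assert (x3 := tan_le_double (K * lambda) ltac:(nra)).
assert (x4 : lambda * tan (K * lambda) <= lambda * (2 * (K * lambda)))
  by (apply Rmult_le_compat_l; lra).
apply Rabs_le; split; nra.
Qed.

Theorem theorem3p2 (g : R -> plane) (T : R) (Omega : plane -> Prop) (k : R)
    (hg : strictly_convex_C2_curve g T Omega)
    (hk : forall t, curvature g t <= k) :
  (forall (n : nat) (t : nat -> R) (lambda : R),
     inscribed T n t ->
     arclength_bound g n t lambda ->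
     lambda < PI / (2 * k) ->
     delta (polygon n (fun i => g (t i))) <= delta (trace g) /\
     delta (trace g)
       <= delta (polygon n (fun i => g (t i))) + lambda * tan (k * lambda)) /\
  (forall eps, 0 < eps -> exists eta, 0 < eta /\
     forall (n : nat) (t : nat -> R) (lambda : R),
       inscribed T n t ->
       arclength_bound g n t lambda ->
       lambda < eta ->
       Rabs (delta (polygon n (fun i => g (t i))) - delta (trace g)) < eps) /\
  (exists C eta, 0 < eta /\
     forall (n : nat) (t : nat -> R) (lambda : R),
       inscribed T n t ->
       arclength_bound g n t lambda ->
       lambda < eta ->
       Rabs (delta (polygon n (fun i => g (t i))) - delta (trace g))
         <= C * lambda ^ 2).
Proof.
assert (hpi := PI_RGT_0).
destruct (delta_polygon_quadratic_error g T Omega k hg hk)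
  as [C [eta [hC [heta h]]]].
split; [|split].
- intros n t lambda ht hl hlam.
  split; [now apply (delta_polygon_le g T Omega)|].
  assert (l0 := arclength_bound_pos g T n t lambda (curve_C2 _ _ _ hg)
    (curve_regular _ _ _ hg) ht hl).
  (* [PI / (2 * k)] is [0] for [k = 0] and negative for [k < 0]. *)
  assert (k0 : 0 < k).
  { apply Rnot_le_lt; intros hk0.
    assert (hinv : / (2 * k) <= 0).
    { destruct hk0 as [hk0| ->]; [|rewrite Rmult_0_r, Rinv_0; lra].
      apply Rlt_le, Rinv_lt_0_compat; lra. }
    unfold Rdiv in hlam; nra. }
  apply (delta_curve_le g T Omega); auto.
  apply Rlt_le_trans with (k * (PI / (2 * k))).
  + now apply Rmult_lt_compat_l.
  + right; field; lra.
(* The bound [eps / C] gives [C * lambda < eps], and the bound 1 absorbs the second factor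
   [lambda]. *)
- intros eps heps; exists (Rmin eta (Rmin 1 (eps / C))); split.
  { repeat apply Rmin_pos; try lra; now apply Rdiv_lt_0_compat. }
  intros n t lambda ht hl hlam.
  assert (m1 := Rmin_l eta (Rmin 1 (eps / C))).
  assert (m2 := Rmin_r eta (Rmin 1 (eps / C))).
  assert (m3 := Rmin_l 1 (eps / C)); assert (m4 := Rmin_r 1 (eps / C)).
  destruct (h n t lambda ht hl ltac:(lra)) as [l0 he].
  apply Rle_lt_trans with (1 := he).
  assert (hCl : C * lambda < eps).
  { replace eps with (C * (eps / C)) by (field; lra).
    apply Rmult_lt_compat_l; lra. }
  nra.
- exists C, eta; split; [exact heta|]; intros n t lambda ht hl hlam.
  apply (h n t lambda ht hl hlam).
Qed.
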